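(* Let $n\ge 3$ be an integer and $q$ a power of a prime. Then $$\mathrm{ex}(\mathcal{L}_n(q); \text{butterfly}) = \mathrm{ex}(\mathcal{L}_n(q); \mathrm{Y}, \mathrm{Y}') = {n \brack \lfloor n/2\rfloor}_q + {n \brack \lfloor n/2\rfloor+1}_q.$$ Moreover, if $\mathcal{F}\subseteq\mathcal{L}_n(q)$ has size ${n \brack \lfloor n/2\rfloor}_q + {n \brack \lfloor n/2\rfloor+1}_q$ and is butterfly-free or $(\mathrm{Y},\mathrm{Y}')$-free, then: (1) if $n$ is odd, $\mathcal{F}$ is the set of all subspaces of dimension $\lfloor n/2\rfloor$ or $\lceil n/2\rceil$; (2) if $n$ is even, $\mathcal{F}$ is either the set of all subspaces of dimension $n/2$ or $n/2+1$, or the set of all subspaces of dimension $n/2$ or $n/2-1$.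
   Context: $\mathcal{L}_n(q)$ is the poset of subspaces of $(\mathbb{F}_q)^n$ ordered by inclusion, $\mathbb{F}_q$ the field of $q$ elements. ${n \brack k}_q = \frac{[n]_q!}{[k]_q![n-k]_q!}$ with $[m]_q=\frac{q^m-1}{q-1}$, $[m]_q!=[m]_q\cdots[1]_q$; it counts $k$-dimensional subspaces. A butterfly is the poset $\{a,b,c,d\}$ with relations $a\le c$, $a\le d$, $b\le c$, $b\le d$. A $\mathrm{Y}$ is the poset $\{a,b,c,d\}$ with $a\le b\le c$ and $b\le d$ (i.e. a butterfly with additionally $a\le b$); a $\mathrm{Y}'$ is the poset $\{a,b,c,d\}$ with $a\le c\le d$ and $b\le c$ (a butterfly with additionally $c\le d$). A poset $P$ contains $Q$ if there is a subset $P_0\subseteq P$ and a bijection $\theta:Q\to P_0$ with $x\le_Q y\Rightarrow\theta(x)\le_P\theta(y)$ (additional relations allowed); otherwise $P$ is $Q$-free. Subsets carry the induced order. $\mathrm{ex}(P;P_1,\dots,P_k)$ is the maximum size of a subset of $P$ containing none of $P_1,\dots,P_k$. *)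

(* Defs.v *)
From HB Require Import structures.
From mathcomp Require Import all_boot all_order all_algebra.

Set Implicit Arguments.
Unset Strict Implicit.
Unset Printing Implicit Defensive.

Import Order.TTheory GRing.Theory.

(* theta is a bijection from Q onto its image, a subset of A; it preserves the
   order but need not reflect it, so A may carry additional relations. *)
Definition contains {dP dQ : Order.disp_t} {P : finPOrderType dP}
    (A : {set P}) (Q : finPOrderType dQ) : bool :=
  [exists theta : {ffun Q -> P},
    [&& injectiveb theta, [forall x, theta x \in A] &
        [forall x, forall y, (x <= y)%O ==> (theta x <= theta y)%O]]].

Definition poset_free {dP dQ : Order.disp_t} {P : finPOrderType dP}
    (Qs : seq (finPOrderType dQ)) (A : {set P}) : bool :=
  all (fun Q => ~~ contains A Q) Qs.

Definition extremal {dP dQ : Order.disp_t} (P : finPOrderType dP)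
    (Qs : seq (finPOrderType dQ)) : nat :=
  \max_(A : {set P} | poset_free Qs A) #|A|.

Variant four : Set := pa | pb | pc | pd.

Definition bools_of_four (x : four) : bool * bool :=
  match x with
  | pa => (false, false) | pb => (false, true)
  | pc => (true, false) | pd => (true, true)
  end.

Definition four_of_bools (u : bool * bool) : four :=
  match u with
  | (false, false) => pa | (false, true) => pb
  | (true, false) => pc | (true, true) => pd
  end.

Lemma bools_of_fourK : cancel bools_of_four four_of_bools.
Proof. by case. Qed.

HB.instance Definition _ := Finite.copy four (can_type bools_of_fourK).

(* The three posets live on copies of one type: the aliases carry distinct
   orders. *)
Definition butterfly : Type := four.
Definition posetY : Type := four.
Definition posetY' : Type := four.

HB.instance Definition _ := Finite.on butterfly.
HB.instance Definition _ := Finite.on posetY.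
HB.instance Definition _ := Finite.on posetY'.

Definition butterfly_le (x y : butterfly) : bool :=
  match x, y with
  | pa, (pa | pc | pd) | pb, (pb | pc | pd) | pc, pc | pd, pd => true
  | _, _ => false
  end.

(* The relation a <= b is added to the butterfly. *)
Definition posetY_le (x y : posetY) : bool :=
  match x, y with
  | pa, _ | pb, (pb | pc | pd) | pc, pc | pd, pd => true
  | _, _ => false
  end.

(* The relation c <= d is added to the butterfly. *)
Definition posetY'_le (x y : posetY') : bool :=
  match x, y with
  | pa, (pa | pc | pd) | pb, (pb | pc | pd) | pc, (pc | pd) | pd, pd => true
  | _, _ => false
  end.

Lemma butterfly_le_refl : reflexive butterfly_le.
Proof. by case. Qed.
Lemma butterfly_le_anti : antisymmetric butterfly_le.
Proof. by do 2!case. Qed.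
Lemma butterfly_le_trans : transitive butterfly_le.
Proof. by do 3!case. Qed.

Lemma posetY_le_refl : reflexive posetY_le.
Proof. by case. Qed.
Lemma posetY_le_anti : antisymmetric posetY_le.
Proof. by do 2!case. Qed.
Lemma posetY_le_trans : transitive posetY_le.
Proof. by do 3!case. Qed.

Lemma posetY'_le_refl : reflexive posetY'_le.
Proof. by case. Qed.
Lemma posetY'_le_anti : antisymmetric posetY'_le.
Proof. by do 2!case. Qed.
Lemma posetY'_le_trans : transitive posetY'_le.
Proof. by do 3!case. Qed.

HB.instance Definition _ :=
  Order.Le_isPOrder.Build (Order.Disp tt tt) butterfly
    butterfly_le_refl butterfly_le_anti butterfly_le_trans.
HB.instance Definition _ :=
  Order.Le_isPOrder.Build (Order.Disp tt tt) posetY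
    posetY_le_refl posetY_le_anti posetY_le_trans.
HB.instance Definition _ :=
  Order.Le_isPOrder.Build (Order.Disp tt tt) posetY'
    posetY'_le_refl posetY'_le_anti posetY'_le_trans.

Lemma leEbutterfly (x y : butterfly) : (x <= y)%O = butterfly_le x y.
Proof. by []. Qed.
Lemma leEposetY (x y : posetY) : (x <= y)%O = posetY_le x y.
Proof. by []. Qed.
Lemma leEposetY' (x y : posetY') : (x <= y)%O = posetY'_le x y.
Proof. by []. Qed.

Definition subspaces (F : finFieldType) (n : nat) : Type := {vspace 'rV[F]_n}.

HB.instance Definition _ F n := Choice.copy (subspaces F n) {vspace 'rV[F]_n}.
HB.instance Definition _ F n :=
  SubChoice.copy (subspaces F n) {vspace 'rV[F]_n}.
HB.instance Definition _ F n := [Finite of subspaces F n by <:].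

Definition subspaces_le (F : finFieldType) (n : nat) (U V : subspaces F n) :
  bool := (U <= V)%VS.

Lemma subspaces_le_refl F n : reflexive (@subspaces_le F n).
Proof. exact: subvv. Qed.
Lemma subspaces_le_anti F n : antisymmetric (@subspaces_le F n).
Proof. exact: subv_anti. Qed.
Lemma subspaces_le_trans F n : transitive (@subspaces_le F n).
Proof. exact: subv_trans. Qed.

HB.instance Definition _ F n :=
  Order.Le_isPOrder.Build (Order.Disp tt tt) (subspaces F n)
    (@subspaces_le_refl F n) (@subspaces_le_anti F n) (@subspaces_le_trans F n).

Lemma leEsubspaces F n (U V : subspaces F n) : (U <= V)%O = (U <= V)%VS.
Proof. by []. Qed.

Definition layer {F : finFieldType} {n : nat} (k : nat) :
    {set subspaces F n} :=
  [set U : subspaces F n | \dim U == k].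

Definition qint (q m : nat) : nat := (q ^ m - 1) %/ (q - 1).

Definition qfact (q m : nat) : nat := \prod_(1 <= i < m.+1) qint q i.

Definition qbinom (q n k : nat) : nat :=
  qfact q n %/ (qfact q k * qfact q (n - k)).

Lemma qint_dvd q m : q - 1 %| q ^ m - 1.
Proof. by rewrite -{2}(exp1n m) subn_exp dvdn_mulr. Qed.

Lemma qintD q m k : 1 < q -> qint q (m + k) = qint q m + q ^ m * qint q k.
Proof.
move=> q1; have q0 : 0 < q - 1 by rewrite subn_gt0.
apply/eqP; rewrite -(eqn_pmul2r q0) mulnDl -mulnA !divnK ?qint_dvd //.
have ge1 e : 0 < q ^ e by rewrite expn_gt0 ltnW.
have le_mk : q ^ m <= q ^ (m + k) by rewrite leq_pexp2l ?leq_addr 1?ltnW.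
by rewrite mulnBr muln1 -expnD addnBA // addnBAC // subnAC addKn.
Qed.

(* Both truncated quotients above are exact. *)
Lemma qbinom_dvd q n k :
  1 < q -> k <= n -> qfact q k * qfact q (n - k) %| qfact q n.
Proof.
move=> q1; suff H m : forall i j, i + j = m -> qfact q i * qfact q j %| qfact q m.
  by move=> kn; apply: H; rewrite subnKC.
have factS e : qfact q e.+1 = qfact q e * qint q e.+1 by rewrite /qfact big_nat_recr.
have fact0 : qfact q 0 = 1 by rewrite /qfact big_geq.
elim: m => [|m IH] [|i] [|j] //.
- by rewrite fact0.
- by rewrite add0n => ->; rewrite fact0 mul1n.
- by rewrite addn0 => ->; rewrite fact0 muln1.
move=> Eij.
have Ei : i + j.+1 = m by apply: succn_inj; rewrite -Eij addSn.
have Ej : i.+1 + j = m by apply: succn_inj; rewrite -Eij addnS.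
rewrite (factS m) -Eij qintD // mulnDr dvdn_add //.
  by rewrite (factS i) mulnAC dvdn_mul // IH.
by rewrite (factS j) mulnA mulnCA dvdn_mull // dvdn_mul // IH.
Qed.

(* Main.v *)
(* Pick a random complete flag (U_0 < ... < U_n); a subspace of dimension k lies
   on it with probability 1 / [n choose k].  Let A contain no Y and no Y'.  If m
   in A has elements of A both below and above it, then it has exactly one, a,
   below and exactly one, b, above.  So a flag through m meets A in m and possibly
   in a and b, and when a <> 0 and b <> V each of these lies on it with conditional
   probability at most 1 / (q + 1) < 1 / 2.  Flags avoiding all such m meet A at
   most twice.  On average a flag thus meets A at most twice, and strictly less if
   some m exists; this bounds #|A| by the two largest layers.  If 0 or V is in A,
   the same count on A minus {0, V} gives an average of at most 1 + 1 / (q + 1),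
   hence a smaller family.  In the equality case for n = 2h, A contains layer h and
   otherwise lives in the layers h - 1 and h + 1, and every flag meets exactly one
   of the two traces; the trace on layer h - 1 is then closed under exchanging one
   dimension, so it is empty or full. *)
Require Import Defs.
From mathcomp Require Import all_boot all_order all_algebra.
From mathcomp Require Import finfield zify.
Set Implicit Arguments.
Unset Strict Implicit.
Unset Printing Implicit Defensive.

Import Order.TTheory.

(** * Counting flags *)

Lemma card_subspace (F : finFieldType) n (U : {vspace 'rV[F]_n}) :
  #|[pred v | v \in U]| = #|F| ^ \dim U.
Proof. by rewrite -(card_vspace U); apply: eq_card. Qed.

(** The predicate is on plain sequences, so [take], [drop] and [::] apply without casts between
    tuple lengths. *)
Definition count_seqs (T : finType) m (Q : pred (seq T)) : nat :=
  #|[pred t : m.-tuple T | Q t]|.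

Lemma count_seqs0 (T : finType) (Q : pred (seq T)) : count_seqs 0 Q = Q [::].
Proof.
rewrite /count_seqs; case: (boolP (Q [::])) => h.
  transitivity #|{: 0.-tuple T}|; last by rewrite card_tuple.
  by apply: eq_card => t; rewrite !inE tuple0 h.
by apply: eq_card0 => t; rewrite !inE tuple0 /= (negbTE h).
Qed.

Lemma count_seqsS (T : finType) m (Q : pred (seq T)) :
  count_seqs m.+1 Q = \sum_x count_seqs m (fun s => Q (x :: s)).
Proof.
rewrite /count_seqs -sum1_card.
rewrite (eq_bigr (fun x => \sum_(t : m.-tuple T | Q (x :: t)) 1)); last first.
  by move=> x _; rewrite sum1_card.
rewrite pair_big_dep /=.
rewrite (reindex (fun u : T * m.-tuple T => [tuple of u.1 :: u.2])) /=; last first.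
  exists (fun t => (thead t, [tuple of behead t])) => [[x t] _|t _] /=.
    by congr (_, _); apply: val_inj.
  by rewrite [RHS]tuple_eta.
by apply: eq_bigl => -[x t].
Qed.

Lemma eq_count_seqs (T : finType) m (Q1 Q2 : pred (seq T)) :
  (forall s, size s = m -> Q1 s = Q2 s) -> count_seqs m Q1 = count_seqs m Q2.
Proof. by move=> h; apply: eq_card => t; rewrite !inE h ?size_tuple. Qed.

Lemma count_seqs_cat (T : finType) a b (Q1 Q2 : pred (seq T)) :
  count_seqs (a + b) (fun s => Q1 (take a s) && Q2 (drop a s)) =
    count_seqs a Q1 * count_seqs b Q2.
Proof.
elim: a Q1 => [|a IH] Q1.
  rewrite count_seqs0 add0n; case: (boolP (Q1 _)) => h.
    by rewrite mul1n; apply: eq_count_seqs => s; rewrite take0 drop0 h.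
  by apply: eq_card0 => t; rewrite !inE take0 (negbTE h).
rewrite addSn !count_seqsS big_distrl /=; apply: eq_bigr => x _.
by rewrite -IH; apply: eq_count_seqs.
Qed.

(** For i <= k: the number of ways to extend a basis of an i-dimensional subspace to an ordered
    basis of a k-dimensional space over the field of [q] elements. *)
Definition frames q i k : nat := \prod_(i <= j < k) (q ^ k - q ^ j).

(** The number of ordered bases of n-space whose first [k] vectors span a fixed subspace;
    [frames q 0 n] divided by it is the Gaussian binomial. *)
Definition nflags q n k := frames q 0 k * frames q k n.

Lemma framesnn q k : frames q k k = 1.
Proof. by rewrite /frames big_geq. Qed.

Section Flags.
Variables (F : finFieldType) (n : nat).
Local Notation q := #|F|.
Implicit Types (U W : {vspace 'rV[F]_n}).

(** The first vector may be anything in [W] outside [U], which gives one factor of [frames]; then [U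
    + <[x]>] takes the place of [U]. *)
Lemma count_frames U W l :
  (U <= W)%VS -> \dim W = \dim U + l ->
  count_seqs l (fun s : seq 'rV[F]_n => (U + <<s>>)%VS == W) = frames q (\dim U) (\dim W).
Proof.
elim: l U => [|l IH] U UW dW.
  rewrite count_seqs0 span_nil addv0 /frames dW addn0 big_geq //.
  by rewrite eqEdim UW dW addn0 leqnn.
rewrite count_seqsS /frames big_ltn; last by lia.
rewrite (bigID (fun x => (x \in W) && (x \notin U))) /= [X in _ + X]big1.
  rewrite addn0 (eq_bigr (fun=> frames q (\dim U).+1 (\dim W))).
    rewrite sum_nat_const; congr (_ * _).
    rewrite -(card_subspace W) -(card_subspace U).
    rewrite -(cardID [pred x | x \in U] [pred x | x \in W]) addnC.
    rewrite [X in _ + X](_ : _ = #|[pred v | v \in U]|) ?addnK.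
      by apply: eq_card => x; rewrite !inE andbC.
    by apply: eq_card => x; rewrite !inE andbC; case: (boolP (x \in U)) => // /(subvP UW) ->.
  move=> x /andP[xW xU].
  have dUx : \dim (U + <[x]>) = (\dim U).+1.
    rewrite dimv_disjoint_sum ?dim_vline.
      by rewrite addnC; case: eqP xU => // ->; rewrite mem0v.
    apply/eqP; rewrite -subv0; apply/subvP => y; rewrite memv_cap memv0.
    case/andP=> yU /vlineP[c yc]; move: yU; rewrite yc.
    case: (eqVneq c 0%R) => [->|c0]; first by rewrite GRing.scale0r eqxx.
    by rewrite GRing.rpredZeq (negbTE c0) (negbTE xU).
  rewrite -dUx -(IH (U + <[x]>)%VS); last 2 first.
  - by rewrite subv_add UW -memvE.
  - by rewrite dUx dW; lia.
  by apply: eq_count_seqs => s _; rewrite span_cons addvA.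
move=> x; rewrite negb_and negbK => xUW.
apply: eq_card0 => t; rewrite !inE span_cons addvA; apply/negbTE.
case/orP: xUW => [xW|xU].
  apply: contra xW => /eqP <-.
  by rewrite memvE (subv_trans _ (addvSl _ _)) // addvSr.
(* A first vector inside [U] leaves only [l] vectors to gain [l + 1] dimensions. *)
apply/eqP => UxtW; have := dim_span t; rewrite size_tuple.
have := (dimv_add_leqif U <<t>>).1.
have Ux : (U + <[x]> = U)%VS by apply/addv_idPl; rewrite -memvE.
by rewrite -{1}Ux UxtW dW => h1 h2; have := leq_trans h1 (leq_add (leqnn _) h2);
  rewrite leq_add2l ltnn.
Qed.

(* A flag is encoded by an ordered basis: its subspace of dimension k is the span
   of the first k vectors.  Every flag has the same number of encodings. *)
Definition flags : {set n.-tuple 'rV[F]_n} :=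
  [set g : n.-tuple 'rV[F]_n | <<g>>%VS == fullv].

Definition members (g : n.-tuple 'rV[F]_n) : {set subspaces F n} :=
  [set U : subspaces F n | <<take (\dim U) g>>%VS == U].

Lemma dim_le (U : subspaces F n) : \dim U <= n.
Proof. by rewrite (leq_trans (dimvS (subvf U))) // dimvf /dim /= mul1n. Qed.

Lemma dim_full : \dim (fullv : {vspace 'rV[F]_n}) = n.
Proof. by rewrite dimvf /dim /= mul1n. Qed.

(** Cut the basis after [\dim U] and after [\dim W] vectors: the three blocks have independent
    counts. *)
Lemma card_flags2 (U W : subspaces F n) : (U <= W)%VS ->
  #|[set g in flags | (U \in members g) && (W \in members g)]| =
    frames q 0 (\dim U) * frames q (\dim U) (\dim W) * frames q (\dim W) n.
Proof.
move=> UW; have dUW := dimvS UW; have dW := dim_le W.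
pose P0 (s : seq 'rV[F]_n) := (0 + <<s>>)%VS == U.
pose P1 (s : seq 'rV[F]_n) := (U + <<s>>)%VS == W.
pose P2 (s : seq 'rV[F]_n) := (W + <<s>>)%VS == fullv.
have <- : count_seqs (\dim U) P0 = frames q 0 (\dim U).
  by rewrite (count_frames (sub0v _)) ?dimv0.
have <- : count_seqs (\dim W - \dim U) P1 = frames q (\dim U) (\dim W).
  by apply: count_frames; rewrite // subnKC.
have <- : count_seqs (n - \dim W) P2 = frames q (\dim W) n.
  have := count_frames (l := n - \dim W) (subvf _); rewrite dim_full.
  by apply; rewrite subnKC.
rewrite -!count_seqs_cat !subnKC //; apply: eq_card => g.
rewrite !inE /P0 /P1 /P2 add0v take_takel // [RHS]andbC.
have gW : (take (\dim W) g) = take (\dim U) g ++ drop (\dim U) (take (\dim W) g).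
  by rewrite -{1}(cat_take_drop (\dim U) (take (\dim W) g)) take_takel.
case: eqP => gf; case: eqP => gU; rewrite ?andbF //=.
- rewrite [in LHS]gW span_cat gU; case: eqP => gW'; rewrite ?andbF //= andbT.
  rewrite -gf -{2}(cat_take_drop (\dim W) g) span_cat.
  by rewrite gW span_cat gU gW' eqxx.
- apply/esym/negP => /andP[/eqP gf' /eqP gW']; case: gf.
  by rewrite -(cat_take_drop (\dim W) g) span_cat gW span_cat gU gW'.
Qed.

Lemma card_flags1 (U : subspaces F n) :
  #|[set g in flags | U \in members g]| = nflags q n (\dim U).
Proof.
have := card_flags2 (subvv U); rewrite framesnn muln1 /nflags => <-.
by apply: eq_card => g; rewrite !inE andbb.
Qed.

Lemma card_flags : #|flags| = frames q 0 n.
Proof.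
have := card_flags1 (0%VS : {vspace 'rV[F]_n}).
rewrite /nflags dimv0 framesnn mul1n => <-.
by apply: eq_card => g; rewrite !inE dimv0 take0 span_nil eqxx andbT.
Qed.

Lemma members_comparable g : {in members g &, forall U W : subspaces F n, (U >=< W)%O}.
Proof.
move=> U W; rewrite !inE => /eqP gU /eqP gW; rewrite /Order.comparable !leEsubspaces.
wlog dUW : U W gU gW / \dim U <= \dim W.
  by case: (leqP (\dim U) (\dim W)) => [|/ltnW] h H; [|rewrite orbC]; apply: H.
apply/orP; left; rewrite -gU -gW -(take_takel g dUW).
by apply: sub_span => x /mem_take.
Qed.

Lemma flag_dim g k : g \in flags -> k <= n -> \dim <<take k g>> = k.
Proof.
rewrite inE => /eqP gf kn.
have := dim_span (take k g); have := dim_span (drop k g).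
rewrite size_take size_drop size_tuple.
have := (dimv_add_leqif <<take k g>> <<drop k g>>).1.
rewrite -span_cat cat_take_drop gf dim_full; case: ifP; lia.
Qed.

Lemma flag_layer g k : g \in flags -> k <= n -> #|members g :&: layer k| = 1.
Proof.
move=> gf kn; apply/eqP/cards1P; exists (<<take k g>>%VS : subspaces F n).
apply/setP => U; rewrite !inE; apply/andP/eqP => [[/eqP gU /eqP dU]|->].
  by rewrite -gU dU.
by rewrite flag_dim ?eqxx.
Qed.

(** Double counting of incidences: a flag has exactly one member of each dimension. *)
Lemma card_layer_nflags k : k <= n -> #|@layer F n k| * nflags q n k = frames q 0 n.
Proof.
move=> kn; rewrite -card_flags -sum_nat_const.
rewrite (eq_bigr (fun U => \sum_(g in flags) (U \in members g))); last first.
  move=> U; rewrite inE => /eqP <-; rewrite -card_flags1 -sum1_card.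
  rewrite [LHS]big_mkcond [RHS]big_mkcond; apply: eq_bigr => g _ /=; rewrite inE.
  by case: (g \in flags); case: (U \in members g).
rewrite exchange_big -sum1_card; apply: eq_bigr => g gf.
rewrite -[RHS](flag_layer gf kn) -sum1_card big_mkcond [RHS]big_mkcond.
apply: eq_bigr => U _; rewrite in_setI.
by case: (U \in layer k); case: (U \in members g).
Qed.

End Flags.

(** * q-factorials and flag numbers *)

Lemma qint1 q : 1 < q -> qint q 1 = 1.
Proof. by move=> q1; rewrite /qint expn1 divnn subn_gt0 q1. Qed.

Lemma qintS q m : 1 < q -> qint q m.+1 = qint q m + q ^ m.
Proof. by move=> q1; rewrite -addn1 qintD // qint1 // muln1. Qed.

Lemma qint_gt0 q m : 1 < q -> 0 < m -> 0 < qint q m.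
Proof.
by move=> q1; case: m => // m _; rewrite qintS // addn_gt0 expn_gt0 (ltnW q1) !orbT.
Qed.

Lemma ltn_qint q : 1 < q -> {homo qint q : i j / i < j}.
Proof.
move=> q1; apply: (@homo_ltn _ _ (fun x y => x < y)) => [y x z|i]; first exact: ltn_trans.
by rewrite qintS // -[ltnLHS]addn0 ltn_add2l expn_gt0 (ltnW q1).
Qed.

Lemma qintK q m : (q - 1) * qint q m = q ^ m - 1.
Proof. by rewrite mulnC divnK ?qint_dvd. Qed.

Lemma qfactS q m : qfact q m.+1 = qfact q m * qint q m.+1.
Proof. by rewrite /qfact big_nat_recr. Qed.

Lemma qfact_gt0 q m : 1 < q -> 0 < qfact q m.
Proof.
move=> q1; elim: m => [|m IH]; first by rewrite /qfact big_geq.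
by rewrite qfactS muln_gt0 IH qint_gt0.
Qed.

Lemma qfact0 q : qfact q 0 = 1.
Proof. by rewrite /qfact big_geq. Qed.

Lemma prod_qint q i k : i <= k -> \prod_(i <= j < k) qint q (k - j) = qfact q (k - i).
Proof.
move=> ik; rewrite /qfact big_add1 /= -{1}[i]add0n big_addn big_nat_rev /=.
rewrite big_nat [RHS]big_nat; apply: eq_bigr => j /andP[_ jk].
by congr qint; lia.
Qed.

Lemma framesE q i k : i <= k ->
  frames q i k = (\prod_(i <= j < k) q ^ j) * ((q - 1) ^ (k - i) * qfact q (k - i)).
Proof.
move=> ik; rewrite -prod_nat_const_nat -prod_qint // -!big_split /=.
rewrite [LHS]big_nat [RHS]big_nat; apply: eq_bigr => j /andP[ij jk].
by rewrite qintK mulnBr muln1 -expnD subnKC // ltnW.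
Qed.

Lemma frames_gt0 q i k : 1 < q -> 0 < frames q i k.
Proof.
move=> q1; case: (leqP i k) => [ik|/ltnW ki]; last by rewrite /frames big_geq.
rewrite framesE // !muln_gt0 qfact_gt0 // andbT expn_gt0 subn_gt0 q1 andbT.
by apply/prodn_gt0 => j; rewrite expn_gt0 ltnW.
Qed.

(** The powers of [q] and of [q - 1] inside [frames] agree on both sides, so only q-factorials
    remain; cross-multiplication avoids division in [nat]. *)
Lemma nflagsE q n k : k <= n ->
  nflags q n k * qfact q n = frames q 0 n * (qfact q k * qfact q (n - k)).
Proof.
move=> kn; rewrite /nflags !framesE // !subn0 [in RHS](big_cat_nat (leq0n k) kn) /=.
have -> : (q - 1) ^ n = (q - 1) ^ k * (q - 1) ^ (n - k) by rewrite -expnD subnKC.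
move: (\prod_(_ <= _ < k) _) (\prod_(_ <= _ < n) _) (qfact q k) (qfact q n) (qfact q _).
move: ((q - 1) ^ k) ((q - 1) ^ _) => a b c d f g h. lia.
Qed.

Lemma nflags_gt0 q n k : 1 < q -> 0 < nflags q n k.
Proof. by move=> q1; rewrite muln_gt0 !frames_gt0. Qed.

Lemma nflags_sym q n k : 1 < q -> k <= n -> nflags q n k = nflags q n (n - k).
Proof.
move=> q1 kn; apply/eqP; rewrite -(eqn_pmul2r (qfact_gt0 n q1)).
by rewrite !nflagsE ?leq_subr // subKn // [qfact _ _ * qfact _ k]mulnC.
Qed.

Lemma nflagsS q n k : 1 < q -> k < n ->
  nflags q n k.+1 * qint q (n - k) = nflags q n k * qint q k.+1.
Proof.
move=> q1 kn; apply/eqP; rewrite -(eqn_pmul2r (qfact_gt0 n q1)).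
rewrite mulnAC nflagsE // [X in _ == X]mulnAC nflagsE ?(ltnW kn) // -(subnSK kn) !qfactS.
by apply/eqP; lia.
Qed.

(** By [nflagsS] consecutive values have ratio [k+1]/[n-k], which exceeds 1 from the middle on. *)
Lemma nflags_upper q n j k : 1 < q -> n <= 2 * j -> j < k <= n ->
  nflags q n j < nflags q n k.
Proof.
move=> q1 nj; elim: k => // k IH /andP[]; rewrite ltnS => jk kn.
have nk : nflags q n k < nflags q n k.+1.
  have I0 : 0 < qint q (n - k) by rewrite qint_gt0 // subn_gt0.
  rewrite -(ltn_pmul2r I0) nflagsS // ltn_pmul2l ?nflags_gt0 //.
  by apply: ltn_qint => //; lia.
move: jk; rewrite leq_eqVlt => /predU1P[->//|jk].
by apply: ltn_trans nk; apply: IH; rewrite jk ltnW.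
Qed.

Lemma nflags_max q n k : 1 < q -> k <= n ->
  nflags q n k = nflags q n (maxn k (n - k)).
Proof. by move=> q1 kn; case: leqP => // _; rewrite -nflags_sym. Qed.

Lemma nflags_lt q n j k : 1 < q -> j <= n -> k <= n ->
  maxn j (n - j) < maxn k (n - k) -> nflags q n j < nflags q n k.
Proof.
move=> q1 jn kn jk; rewrite nflags_max // [ltnRHS]nflags_max //.
by apply: nflags_upper => //; lia.
Qed.

Lemma nflags_le q n j k : 1 < q -> j <= n -> k <= n ->
  maxn j (n - j) <= maxn k (n - k) -> nflags q n j <= nflags q n k.
Proof.
move=> q1 jn kn; rewrite leq_eqVlt => /predU1P[jk|jk]; last exact/ltnW/nflags_lt.
by rewrite nflags_max // [leqRHS]nflags_max // jk.
Qed.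

Lemma qbinomE q n k : 1 < q -> k <= n ->
  qbinom q n k * nflags q n k = frames q 0 n.
Proof.
move=> q1 kn; apply/eqP; rewrite -(eqn_pmul2r (qfact_gt0 n q1)) -mulnA nflagsE //.
by rewrite mulnCA eqn_pmul2l ?frames_gt0 // divnK // qbinom_dvd.
Qed.

(** The source of the bound 1 / (q + 1) on the probability that a flag through nested subspaces of
    dimensions [lo] and [n] also contains a given one of dimension [l] between them. *)
Lemma frames_gap q lo l n : 1 < q -> lo < l < n ->
  q.+1 * (frames q lo l * frames q l n) <= frames q lo n.
Proof.
move=> q1 /andP[lol ln].
rewrite [leqRHS]/frames (big_cat_nat (ltnW lol) (ltnW ln)) /= mulnA leq_mul2r.
apply/orP; right; case: l lol ln => // l lol ln.
(* All factors but the last are compared one by one; the last supplies q + 1, since (q + 1)(q^(l+1)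
   - q^l) = q^(l+2) - q^l. *)
rewrite /frames !big_nat_recr //= mulnCA; apply: leq_mul.
  by apply: leq_prod => j _; apply: leq_sub2r; rewrite leq_exp2l // ltnW.
rewrite mulSn mulnBr -!expnS; have q0 := ltnW q1.
have := leq_pexp2l q0 ln; have := leq_pexp2l q0 (leqnSn l.+1).
by have := leq_pexp2l q0 (leqnSn l); lia.
Qed.

(** Layer k is at least as large as layer n - 1, which has [n]_q > [2]_q = q + 1 >= 3 members. *)
Lemma qbinom_ge4 q n k : 1 < q -> 2 < n -> n <= 2 * k -> k < n -> 3 < qbinom q n k.
Proof.
move=> q1 n2 nk kn; have nf := nflags_gt0 n k q1.
case: n n2 nk kn nf => // n n2 nk kn nf.
have n3 : 3 < qint q n.+1.
  have := @ltn_qint q q1 2 n.+1 n2.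
  by rewrite qintS // qint1 // expn1; lia.
apply: leq_trans n3 _.
have le_nk : nflags q n.+1 k <= nflags q n.+1 n by apply: nflags_le => //; lia.
have nS : nflags q n.+1 n * qint q n.+1 = frames q 0 n.+1.
  apply/eqP; rewrite -(eqn_pmul2r (qfact_gt0 n.+1 q1)) mulnAC nflagsE //.
  by rewrite subSnn !qfactS qfact0 qint1 // !muln1 mulnA.
rewrite -(leq_pmul2r nf) qbinomE ?(ltnW kn) // -nS mulnC leq_mul2r le_nk orbT //.
Qed.

(** * Chain counting in a finite poset *)

Lemma chain_lt (d : Order.disp_t) (P : finPOrderType d) (C : {set P}) :
  {in C &, forall x y, (x >=< y)%O} -> 1 < #|C| ->
  exists x y, [/\ x \in C, y \in C & (x < y)%O].
Proof.
move=> Cc /card_gt1P[x [y [xC yC xy]]].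
by case: (comparable_ltgtP (Cc x y xC yC)) xy => // xy _; [exists x, y|exists y, x].
Qed.

Lemma chain_lt_lt (d : Order.disp_t) (P : finPOrderType d) (C : {set P}) :
  {in C &, forall x y, (x >=< y)%O} -> 2 < #|C| ->
  exists x y z, [/\ x \in C, y \in C, z \in C, (x < y)%O & (y < z)%O].
Proof.
move=> Cc /card_gt2P[x [y [z [[xC yC zC] [xy yz zx]]]]].
case: (comparable_ltgtP (Cc x y xC yC)) xy => // xy _;
case: (comparable_ltgtP (Cc y z yC zC)) yz => // yz _;
case: (comparable_ltgtP (Cc z x zC xC)) zx => // zx _.
- by exists x, y, z.
- by exists x, y, z.
- by exists z, x, y.
- by exists x, z, y.
- by exists y, z, x.
- by exists y, x, z.
- by exists z, y, x.
- by exists z, y, x.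
Qed.

(** * LYM-type inequalities for an abstract family of chains *)

Section LYM.
Variables (d : Order.disp_t) (P : finPOrderType d) (G : finType).
Variables (flg : {set G}) (mb : G -> {set P}).
Hypothesis mb_comparable : forall g, {in mb g &, forall x y, (x >=< y)%O}.

Definition through (D : {set G}) (x : P) : {set G} := [set g in D | x \in mb g].

Lemma sum_through D (A : {set P}) (f : P -> G -> nat) :
  \sum_(x in A) \sum_(g in through D x) f x g =
  \sum_(g in D) \sum_(x in A :&: mb g) f x g.
Proof.
rewrite (exchange_big_dep (fun g => g \in D)) /=; last by move=> x g _; rewrite inE => /andP[].
by apply: eq_bigr => g gD; apply: eq_bigl => x; rewrite !inE gD.
Qed.

Lemma card_through D (A : {set P}) :
  \sum_(x in A) #|through D x| = \sum_(g in D) #|A :&: mb g|.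
Proof.
rewrite (eq_bigr (fun x => \sum_(g in through D x) 1)); last first.
  by move=> x _; rewrite sum1_card.
by rewrite sum_through; apply: eq_bigr => g _; rewrite sum1_card.
Qed.

(* The members of D absorb the excess of the flags meeting A too often: on such a
   flag the excess is paid for by the pairs (m, x) with m in D and x in A. *)
Lemma lym_core (A D : {set P}) s t e c :
  (forall g, g \in flg ->
     #|A :&: mb g| + e * #|D :&: mb g| <=
       t + \sum_(m in D :&: mb g) #|(A :\ m) :&: mb g|) ->
  (forall m, m \in D -> #|[set x in A :\ m | (x >=< m)%O]| <= c) ->
  (forall m x, m \in D -> x \in A -> x != m -> (x >=< m)%O ->
     s * #|through (through flg m) x| <= #|through flg m|) ->
  s * \sum_(x in A) #|through flg x| + s * e * \sum_(m in D) #|through flg m| <=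
    s * t * #|flg| + c * \sum_(m in D) #|through flg m|.
Proof.
move=> flag_le comp_le gap.
have -> : s * t * #|flg| = s * (t * #|flg|) by rewrite mulnA.
rewrite -mulnA -mulnDr.
apply: (@leq_trans (s * (t * #|flg| +
    \sum_(m in D) \sum_(g in through flg m) #|(A :\ m) :&: mb g|))).
  rewrite leq_mul2l; apply/orP; right.
  rewrite !card_through sum_through big_distrr /= -big_split /= mulnC -sum_nat_const.
  by rewrite -big_split /=; apply: leq_sum => g; apply: flag_le.
rewrite mulnDr leq_add2l !big_distrr /=; apply: leq_sum => m mD.
rewrite -card_through.
(* Elements incomparable to [m] share no flag with it, so only the at most [c] comparable ones
   contribute. *)
apply: leq_trans (_ : \sum_(x in [set x in A :\ m | (x >=< m)%O]) #|through flg m| <= _).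
  rewrite (bigID (fun x => (x >=< m)%O)) /= [X in _ + X]big1 ?addn0.
    rewrite big_distrr /= (eq_bigl (fun x => x \in [set x in A :\ m | (x >=< m)%O])).
      by apply: leq_sum => x; rewrite !inE => /andP[/andP[xm xA] xc]; apply: gap.
    by move=> x; rewrite !inE.
  move=> x /andP[_ xm]; apply: eq_card0 => g; rewrite !inE.
  by apply: contraNF xm => /andP[/andP[_ mg] xg]; apply: mb_comparable mg.
by rewrite sum_nat_const leq_mul2r comp_le ?orbT.
Qed.

Definition mids (A : {set P}) : {set P} :=
  [set m in A | [exists a in A, (a < m)%O] && [exists b in A, (m < b)%O]].

(** The first conjunct forbids a [posetY] with stem a < m, the second a [posetY'] with stem m <
    c. *)
Definition no_fork (A : {set P}) :=
  (forall a m b c, a \in A -> m \in A -> b \in A -> c \in A ->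
     (a < m)%O -> (m < b)%O -> (m < c)%O -> b = c) /\
  (forall a b m c, a \in A -> b \in A -> m \in A -> c \in A ->
     (a < m)%O -> (b < m)%O -> (m < c)%O -> a = b).

Lemma midsP (A : {set P}) m : reflect
  (exists a b, [/\ a \in A, m \in A, b \in A, (a < m)%O & (m < b)%O]) (m \in mids A).
Proof.
rewrite inE; apply: (iffP and3P) => [[mA /exists_inP[a aA am] /exists_inP[b bA mb']]|].
  by exists a, b.
move=> [a [b [aA mA bA am mb']]]; split=> //; apply/exists_inP; first by exists a.
by exists b.
Qed.

Lemma mids_nbr (A : {set P}) m : no_fork A -> m \in mids A ->
  exists a b, [/\ a \in A, b \in A, (a < m)%O, (m < b)%O &
    forall x, x \in A -> x != m -> (x >=< m)%O -> x = a \/ x = b].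
Proof.
move=> [upA dnA] /midsP[a [b [aA mA bA am mb']]]; exists a, b; split=> // x xA xm cxm.
case: (comparable_ltgtP cxm) xm => // xm _; last by right; apply: (upA a m).
by left; apply: (dnA x a m b).
Qed.

(** The slack term with factor [s - 2] is kept because it forces [mids A] to be empty in the
    equality case. *)
Lemma lym_mids (A : {set P}) s : 1 < s -> no_fork A ->
  {in A &, forall m x, x != m -> (x >=< m)%O ->
     s * #|through (through flg m) x| <= #|through flg m|} ->
  s * \sum_(x in A) #|through flg x| + (s - 2) * \sum_(m in mids A) #|through flg m|
    <= s * 2 * #|flg|.
Proof.
move=> s2 nfA gap.
have sub_mids m : m \in mids A -> m \in A by case/midsP => [? [? []]].
(* Two members per flag are free ([t] = 2), each middle element carries one extra unit ([e] = 1),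
   and it has at most two neighbours in [A] ([c] = 2). *)
have := @lym_core A (mids A) s 2 1 2; rewrite muln1 mulnBl => core.
have {core} : s * \sum_(x in A) #|through flg x| + s * \sum_(m in mids A) #|through flg m|
    <= s * 2 * #|flg| + 2 * \sum_(m in mids A) #|through flg m|; last first.
  move: (\sum_(x in A) _) (\sum_(m in mids A) _) => a b;
    have : 2 * b <= s * b by rewrite leq_mul2r s2 orbT.
  move: (s * a) (s * b) (s * _ * _); lia.
apply: core => [g gf|m mM|m x mM xA]; last exact: (gap m x (sub_mids m mM) xA).
  have Cc : {in A :&: mb g &, forall x y, (x >=< y)%O}.
    by move=> x y /setIP[_ xg] /setIP[_ yg]; apply: (mb_comparable xg).
  case: (posnP #|mids A :&: mb g|) => [M0|].
    rewrite M0 muln0 addn0 (leq_trans _ (leq_addr _ _)) // leqNgt; apply/negP.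
    case/(chain_lt_lt Cc) => x [y [z [/setIP[xA _] /setIP[yA yg] /setIP[zA _] xy yz]]].
    have : y \in mids A :&: mb g by rewrite inE yg andbT; apply/midsP; exists x, z.
    by rewrite (cards0_eq M0) inE.
  rewrite (eq_bigr (fun=> #|A :&: mb g|.-1)); last first.
    move=> m /setIP[mM mg]; rewrite (cardsD1 m (A :&: mb g)) inE sub_mids // mg /=.
    by apply: eq_card => x; rewrite !inE andbA.
  (* With k members of [A] and M >= 1 middle elements on the flag, the claim is (M - 1)(k - 2) >= 0;
     M <= k settles k = 1. *)
  have : #|mids A :&: mb g| <= #|A :&: mb g|.
    by apply/subset_leq_card/setSI/subsetP.
  rewrite sum_nat_const mul1n; nia.
have [a [b [aA bA am mb' nbr]]] := mids_nbr nfA mM.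
apply: leq_trans (_ : #|[set a; b]| <= 2); last by rewrite cards2; case: eqP.
apply/subset_leq_card/subsetP => x; rewrite !inE => /andP[/andP[xm xA] cxm].
by apply/orP; case: (nbr x xA xm cxm) => ->; [left|right].
Qed.

(** Together with [e], any comparable pair in [B] forms a 3-chain, so one of the two is a middle
    element. One of its two neighbours is [e], which leaves at most one in [B]; hence [t] = 1 and
    [c] = 1 in [lym_core]. *)
Lemma lym_extremum (A B : {set P}) e s : no_fork A -> e \in A ->
  (forall x, x \in A -> (e <= x)%O) \/ (forall x, x \in A -> (x <= e)%O) ->
  B \subset A :\ e ->
  {in B &, forall m x, x != m -> (x >=< m)%O ->
     s * #|through (through flg m) x| <= #|through flg m|} ->
  s * \sum_(x in B) #|through flg x| <= s.+1 * #|flg|.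
Proof.
move=> nfA eA ext /subsetP sBA gap; have [upA dnA] := nfA.
have sB x : x \in B -> x \in A /\ x != e by move/sBA; rewrite !inE => /andP[].
have ext_lt x y : x \in B -> y \in B -> (x < y)%O ->
    x \in mids A \/ y \in mids A.
  move=> /sB[xA xe] /sB[yA ye] xy.
  case: ext => ext; [left|right].
    have ex : (e < x)%O by rewrite lt_neqAle eq_sym xe ext.
    by apply/midsP; exists e, y.
  have ye' : (y < e)%O by rewrite lt_neqAle ye ext.
  by apply/midsP; exists x, e.
(* For middle elements x < y, both x and the element of [A] below x would lie below y, which has an
   element above it: a fork. *)
have D1 g : #|(mids A :&: B) :&: mb g| <= 1.
  rewrite leqNgt; apply/negP => /chain_lt[]; last first.
    move=> x [y [/setIP[/setIP[xM xB] _] /setIP[/setIP[yM yB] _] xy]].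
    have [[xA xe] [yA ye]] := (sB x xB, sB y yB).
    have /midsP[a [b [aA _ bA ax xb]]] := xM.
    have /midsP[a' [b' [aA' _ bA' ay yb]]] := yM.
    have ay' : a = x by apply: (dnA a x y b') => //; apply: lt_trans xy.
    by rewrite ay' ltxx in ax.
  by move=> x y /setIP[_ xg] /setIP[_ yg]; apply: (mb_comparable xg).
have sumD : \sum_(m in mids A :&: B) #|through flg m| <= #|flg|.
  rewrite card_through -sum1_card; apply: leq_sum => g _; exact: D1.
have := @lym_core B (mids A :&: B) s 1 0 1; rewrite muln0 mul0n addn0 muln1 mul1n => core.
rewrite mulSn addnC; apply: leq_trans (core _ _ _) _; last by rewrite leq_add2l.
- move=> g gf; rewrite mul0n addn0.
  have Cc : {in B :&: mb g &, forall x y, (x >=< y)%O}.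
    by move=> x y /setIP[_ xg] /setIP[_ yg]; apply: (mb_comparable xg).
  case: (posnP #|(mids A :&: B) :&: mb g|) => [M0|].
    rewrite (leq_trans _ (leq_addr _ _)) // leqNgt; apply/negP.
    case/(chain_lt Cc) => x [y [/setIP[xB xg] /setIP[yB yg] xy]].
    have [xM|yM] := ext_lt x y xB yB xy.
      have : x \in (mids A :&: B) :&: mb g by apply/setIP; split=> //; apply/setIP.
      by rewrite (cards0_eq M0) inE.
    have : y \in (mids A :&: B) :&: mb g by apply/setIP; split=> //; apply/setIP.
    by rewrite (cards0_eq M0) inE.
  rewrite (eq_bigr (fun=> #|B :&: mb g|.-1)); last first.
    move=> m /setIP[/setIP[_ mB] mg]; rewrite (cardsD1 m (B :&: mb g)) inE mB mg /=.
    by apply: eq_card => x; rewrite !inE andbA.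
  rewrite sum_nat_const; nia.
- move=> m /setIP[mM mB]; have [a [b [aA bA am mb' nbr]]] := mids_nbr nfA mM.
  have [mA me] := sB m mB.
  rewrite leqNgt; apply/negP => /card_gt1P[x [y []]].
  rewrite !inE => /andP[/andP[xm xB] xc] /andP[/andP[ym yB] yc] /eqP; apply.
  have [[xA xe] [yA ye]] := (sB x xB, sB y yB).
  (* [e] is [a] or [b], so [x] and [y] both equal the other one. *)
  have ec : (e >=< m)%O.
    by rewrite /Order.comparable; case: ext => /(_ m mA) ->; rewrite ?orbT.
  rewrite eq_sym in me; move: xe ye.
  by case: (nbr e eA me ec) (nbr x xA xm xc) (nbr y yA ym yc) => -> [] -> [] ->;
    rewrite ?eqxx.
- by move=> m x /setIP[_ mB] xB; apply: (gap m x mB xB).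
Qed.

End LYM.

(** * Families of subspaces *)

Lemma embedding_contains (dP dQ : Order.disp_t) (P : finPOrderType dP)
    (Q : finPOrderType dQ) (A : {set P}) (f : Q -> P) :
  injective f -> (forall x, f x \in A) -> {homo f : x y / (x <= y)%O} -> contains A Q.
Proof.
move=> fI fA fle; apply/existsP; exists (finfun f); apply/and3P; split.
- by apply/injectiveP => x y; rewrite !ffunE => /fI.
- by apply/forallP => x; rewrite ffunE.
- by apply/forallP => x; apply/forallP => y; apply/implyP => /fle; rewrite !ffunE.
Qed.

Definition four_fun (T : Type) (a b c d : T) (x : four) : T :=
  match x with pa => a | pb => b | pc => c | pd => d end.

Lemma four_fun_inj (T : eqType) (a b c d : T) :
  uniq [:: a; b; c; d] -> injective (four_fun a b c d).
Proof.
rewrite /= !inE !negb_or => /and4P[/and3P[/eqP ab /eqP ac /eqP ad] /andP[/eqP bc /eqP bd] /eqP cd _].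
by case; case=> //= e; congruence.
Qed.

Lemma YY'_free_no_fork (d : Order.disp_t) (P : finPOrderType d) (A : {set P}) :
  poset_free [:: posetY : finPOrderType _; posetY' : finPOrderType _] A -> no_fork A.
Proof.
case/and3P => /negP nY /negP nY' _; split.
- move=> a m b c aA mA bA cA am mb mc; apply/eqP; apply: contraT => bc; case: nY.
  have [ab ac] := (lt_trans am mb, lt_trans am mc).
  apply: (@embedding_contains _ _ P (posetY : finPOrderType _) A (four_fun a m b c)).
  + by apply: four_fun_inj; rewrite /= !inE !negb_or bc !lt_eqF //.
  + by case.
  + by case; case=> //= _; rewrite ?lexx // ltW.
- move=> a b m c aA bA mA cA am bm mc; apply/eqP; apply: contraT => ab; case: nY'.
  have [ac bc] := (lt_trans am mc, lt_trans bm mc).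
  apply: (@embedding_contains _ _ P (posetY' : finPOrderType _) A (four_fun a b m c)).
  + by apply: four_fun_inj; rewrite /= !inE !negb_or ab !lt_eqF //.
  + by case.
  + by case; case=> //= _; rewrite ?lexx // ltW.
Qed.

(** The three orders share the carrier [four] and the butterfly's is the weakest, so the same map
    embeds the butterfly. *)
Lemma butterfly_free_YY' (d : Order.disp_t) (P : finPOrderType d) (A : {set P}) :
  poset_free [:: butterfly : finPOrderType _] A ->
  poset_free [:: posetY : finPOrderType _; posetY' : finPOrderType _] A.
Proof.
case/andP => /negP nB _; apply/and3P; split=> //;
  apply/negP => /existsP[f /and3P[/injectiveP fI /forallP fA /forallP fle]];
  apply: nB;
    apply: (@embedding_contains _ _ P (butterfly : finPOrderType _) A (f : four -> P)) => //;
  move=> x y xy; have /forallP/(_ y)/implyP := fle x; apply; move: x y xy; by case; case.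
Qed.

(** * Weights of subspaces and exchange arguments *)

Section Subspaces.
Variables (F : finFieldType) (n : nat).
Local Notation q := #|F|.
Local Notation V := (subspaces F n).
Local Notation flg := (@flags F n).
Local Notation mb := (@members F n).
Local Notation wt x := #|through mb flg x|.

Lemma cardF_gt1 : 1 < q.
Proof. exact: finNzRing_gt1. Qed.

Lemma dim_lt (U W : V) : (U < W)%O -> \dim U < \dim W.
Proof.
rewrite lt_neqAle leEsubspaces => /andP[UW le]; rewrite ltn_neqAle dimvS // andbT.
by apply: contra UW => /eqP e; rewrite eqEdim le e leqnn.
Qed.

Lemma weightE (U : V) : wt U = nflags q n (\dim U).
Proof. exact: card_flags1. Qed.

(** Excluding 0 and the whole space puts [x] strictly inside the interval below or above [m], where
    [frames_gap] applies. *)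
Lemma weight_gap (m x : V) : (x >=< m)%O -> x != m -> x != 0%VS -> x != fullv ->
  q.+1 * #|through mb (through mb flg m) x| <= wt m.
Proof.
move=> cxm xm x0 x1; rewrite weightE /nflags.
have dx : 0 < \dim x < n.
  rewrite lt0n dimv_eq0 x0 ltn_neqAle dim_le andbT /=.
  by apply: contra x1; move=> /eqP e; rewrite eqEdim subvf dim_full e leqnn.
have th : #|through mb (through mb flg m) x| =
    #|[set g in flg | (x \in mb g) && (m \in mb g)]|.
  by apply: eq_card => g; rewrite !inE -andbA [in RHS](andbC (_ == x)).
rewrite th; case: (comparable_ltgtP cxm) xm => // [xm|mx] _.
  have xle : (x <= m)%VS := ltW xm.
  rewrite (card_flags2 xle) mulnA leq_mul2r frames_gap ?orbT ?cardF_gt1 //.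
  by case/andP: dx => -> _; rewrite dim_lt.
rewrite (eq_card (B := [set g in flg | (m \in mb g) && (x \in mb g)])); last first.
  by move=> g; rewrite !inE [in RHS](andbC (_ == m)).
have mle : (m <= x)%VS := ltW mx.
rewrite (card_flags2 mle) -!mulnA mulnCA leq_mul2l frames_gap ?orbT ?cardF_gt1 //.
by rewrite dim_lt //; case/andP: dx.
Qed.

Lemma card_layer k : k <= n -> #|@layer F n k| = qbinom q n k.
Proof.
move=> kn; apply/eqP; rewrite -(eqn_pmul2r (nflags_gt0 n k cardF_gt1)).
by rewrite card_layer_nflags // qbinomE ?cardF_gt1.
Qed.

Lemma flag_through2 (U W : V) : (U <= W)%VS -> exists2 g, g \in flg & (U \in mb g) && (W \in mb g).
Proof.
move=> UW; have /card_gt0P[g] : 0 < #|[set g in flg | (U \in mb g) && (W \in mb g)]|.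
  by rewrite card_flags2 // !muln_gt0 !frames_gt0 ?cardF_gt1.
by rewrite inE => /andP[]; exists g.
Qed.

Lemma subspace_between (U W : V) k : (U <= W)%VS -> \dim U <= k <= \dim W ->
  exists Z : V, [/\ (U <= Z)%VS, (Z <= W)%VS & \dim Z = k].
Proof.
move=> UW /andP[Uk kW]; have [g gf /andP[]] := flag_through2 UW.
rewrite !inE => /eqP gU /eqP gW; exists <<take k g>>%VS; split.
- by rewrite -gU -(take_takel g Uk); apply: sub_span => x /mem_take.
- by rewrite -gW -(take_takel g kW); apply: sub_span => x /mem_take.
- by rewrite flag_dim // (leq_trans kW) // dim_le.
Qed.

(** Move from [U] towards [U']: replace [U] by [H + <[u]>], with [u] in [U'] outside [U] and [H] a
    hyperplane of [U] containing the intersection. The intersection with [U'] grows at each move. *)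
Lemma exchange_connected (S : {set V}) k : k.+1 < n ->
  (forall U U' W : V, U \in S -> \dim U' = k -> \dim W = k.+2 ->
     (U <= W)%VS -> (U' <= W)%VS -> U' \in S) ->
  S \subset layer k -> S != set0 -> layer k \subset S.
Proof.
move=> kn Scl /subsetP Sk /set0Pn[U0 U0S]; apply/subsetP => U'; rewrite inE => /eqP dU'.
have [r] := ubnP (k - \dim (U0 :&: U')%VS); elim: r U0 U0S => // r IH U US le_r.
have dU : \dim U = k by apply/eqP; have := Sk _ US; rewrite inE.
have [U'U|/subvPn[u uU' uU]] := boolP (U' <= U)%VS.
  suff -> : U' = U by [].
  by apply/eqP; rewrite eqEdim U'U dU dU' /=.
have dcap : \dim (U :&: U')%VS < k.
  rewrite ltn_neqAle -{2}dU dimvS ?capvSl // andbT; apply: contra uU => /eqP dc.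
  have /eqP capU' : (U :&: U' == U')%VS by rewrite eqEdim capvSr dc dU' leqnn.
  by move: uU'; rewrite -capU' memv_cap => /andP[].
have [H [capH HU dH]] : exists Z : V, [/\ (U :&: U' <= Z)%VS, (Z <= U)%VS & \dim Z = k.-1].
  apply: subspace_between; first exact: capvSl.
  by rewrite dU leq_pred andbT -ltnS prednK // (leq_trans _ dcap).
have line_dim (X : V) : (X <= U)%VS -> \dim (X + <[u]>)%VS = (\dim X).+1.
  move=> XU; rewrite dimv_disjoint_sum ?dim_vline.
    by rewrite addnC; case: eqP uU => // ->; rewrite mem0v.
  apply/eqP; rewrite -subv0; apply/subvP => y; rewrite memv_cap memv0.
  case/andP=> /(subvP XU) yU /vlineP[c yc]; move: yU; rewrite yc.
  case: (eqVneq c 0%R) => [->|c0]; first by rewrite GRing.scale0r eqxx.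
  by rewrite GRing.rpredZeq (negbTE c0) (negbTE uU).
(* [U + <[u]>] has dimension k + 1; it is enlarged once more because closure is assumed only through
   spaces of dimension k + 2. *)
have [W [UuW _ dW]] : exists Z : V, [/\ (U + <[u]> <= Z)%VS, (Z <= fullv)%VS & \dim Z = k.+2].
  apply: subspace_between; first exact: subvf.
  by rewrite line_dim // dU leqnSn dim_full.
have HuS : (H + <[u]>)%VS \in S.
  apply: (Scl U _ W) => //.
  - by rewrite line_dim // dH prednK // (leq_trans _ dcap).
  - by apply: subv_trans UuW; apply: addvSl.
  - by apply: subv_trans UuW; apply: addvS.
apply: IH HuS _; rewrite -ltnS; apply: leq_trans le_r; rewrite ltnS.
apply: ltn_sub2l => //; rewrite -(line_dim (U :&: U')%VS) ?capvSl //.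
by apply: dimvS; rewrite subv_cap addvS // subv_add capvSr -memvE.
Qed.

(** Every flag meets [S] and [T] at most once in total, and the cardinality hypothesis makes the
    average 1, so each meets them exactly once. Apply this to a flag through [U] and [W]. *)
Lemma flags_split (S T : {set V}) k : k.+2 <= n ->
  S \subset layer k -> T \subset layer k.+2 ->
  nflags q n k = nflags q n k.+2 -> #|S| + #|T| = #|@layer F n k.+2| ->
  (forall U W, U \in S -> W \in T -> (U <= W)%VS -> False) ->
  forall U W : V, \dim U = k -> \dim W = k.+2 -> (U <= W)%VS -> (U \in S) || (W \in T).
Proof.
move=> kn /subsetP Sk /subsetP Tk ekk eST nST U W dU dW UW.
have kn' : k <= n by lia.
have le1 g : g \in flg -> #|S :&: mb g| + #|T :&: mb g| <= 1.
  move=> gf.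
  have leS : #|S :&: mb g| <= 1.
    by rewrite -(flag_layer gf kn') setIC subset_leq_card // setIS //; apply/subsetP.
  have leT : #|T :&: mb g| <= 1.
    by rewrite -(flag_layer gf kn) setIC subset_leq_card // setIS //; apply/subsetP.
  case: (posnP #|S :&: mb g|) => [->//|/card_gt0P[X /setIP[XS Xg]]].
  case: (posnP #|T :&: mb g|) => [->|/card_gt0P[Y /setIP[YT Yg]]]; first by rewrite addn0.
  case: (nST X Y) => //; have := members_comparable Xg Yg.
  rewrite /Order.comparable !leEsubspaces => /orP[//|YX].
  by have := dimvS YX; have := Sk _ XS; have := Tk _ YT; rewrite !inE => /eqP -> /eqP ->; lia.
have sumST : \sum_(g in flg) (#|S :&: mb g| + #|T :&: mb g|) = \sum_(g in flg) 1.
  rewrite big_split /= -!card_through sum1_card card_flags -(card_layer_nflags F kn) -eST mulnDl.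
  congr (_ + _).
    by rewrite -ekk -sum_nat_const; apply: eq_bigr => X /Sk; rewrite inE weightE => /eqP ->.
  by rewrite -sum_nat_const; apply: eq_bigr => X /Tk; rewrite inE weightE => /eqP ->.
have [g gf /andP[gU gW]] := flag_through2 UW.
have /leqif_sum h : forall g, g \in flg ->
    #|S :&: mb g| + #|T :&: mb g| <= 1 ?= iff (#|S :&: mb g| + #|T :&: mb g| == 1).
  by move=> g' g'f; split; rewrite ?le1.
have /forall_inP/(_ g gf) : [forall (g | g \in flg), #|S :&: mb g| + #|T :&: mb g| == 1].
  by rewrite -h.2 sumST eqxx.
case: (posnP #|S :&: mb g|) => [->|/card_gt0P[X /setIP[XS Xg]] _].
  rewrite add0n => /eqP/esym T1;
    have /card_gt0P[Y /setIP[YT Yg]] : 0 < #|T :&: mb g| by rewrite -T1.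
  have := Tk _ YT; rewrite inE => /eqP dY; move: Yg gW; rewrite !inE dY dW => /eqP YE /eqP.
  by rewrite YE => <-; rewrite YT orbT.
have := Sk _ XS; rewrite inE => /eqP dX; move: Xg gU; rewrite !inE dX dU => /eqP XE /eqP.
by rewrite XE => <-; rewrite XS.
Qed.

Lemma card_layerU i j : i <= n -> j <= n -> i != j ->
  #|layer i :|: layer j : {set V}| = qbinom q n i + qbinom q n j.
Proof.
move=> ni nj ij; rewrite cardsU !card_layer // (_ : _ :&: _ = set0) ?cards0 ?subn0 //.
by apply/setP => U; rewrite !inE; apply/negP => /andP[/eqP ->]; apply/negP.
Qed.

Lemma sum_weight_ge (A : {set V}) k c : 
  (forall x : V, \dim x != k -> c <= wt x) ->
  #|A :&: layer k| * nflags q n k + #|A :\: layer k| * c <= \sum_(x in A) wt x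
    ?= iff [forall x in A :\: layer k, c == wt x].
Proof.
move=> cle; rewrite (big_setID (layer k)) /= -!sum_nat_const.
rewrite [X in _ <= X + _ ?= iff _](eq_bigr (fun=> nflags q n k)); last first.
  by move=> x; rewrite !inE weightE => /andP[_ /eqP ->].
split; first by rewrite leq_add2l; apply: leq_sum => x; rewrite !inE => /andP[/cle].
rewrite eqn_add2l; apply: (leqif_sum _).2 => x; rewrite !inE => /andP[/cle xc _].
by split.
Qed.

(** A budget of 2f buys the most members by taking all N at the cheaper price [c] and N' at price
    [c']; a different split costs the same only if the prices agree. *)
Lemma two_layers_optimum N N' a r c c' f w :
  c <= c' -> 0 < c' -> N * c = f -> N' * c' = f -> a <= N ->
  a * c + r * c' <= w -> w <= 2 * f -> N + N' <= a + r ->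
  [/\ a + r = N + N', w = 2 * f, a * c + r * c' = w & a = N \/ c = c'].
Proof.
move=> cc' c'0 Nf N'f aN aw wf le_r.
have {le_r} [u ru] : exists u, r = (N - a) + N' + u by exists (r - (N - a) - N'); lia.
have {aN} [t Nt] : exists t, N = a + t by exists (N - a); lia.
have {cc'} [e ce] : exists e, c' = c + e by exists (c' - c); lia.
have {}ru : r = t + N' + u by lia.
(* [u] is the surplus over N + N', [t] the number of vacancies in the cheap layer, [e] the price
   difference; the budget leaves no room for either product. *)
subst r c' N; have te0 : t * e + u * (c + e) = 0 by nia.
have u0 : u = 0 by nia.
have : t = 0 \/ e = 0 by nia.
by subst u; case=> ?; subst; split; try nia; lia.
Qed.

(** The budget (1 + 1/s)f buys at most N + N'/s members. As s >= 3 and N' > 3, this stays below N +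
    N' even after adding back 0 and the whole space. *)
Lemma extremum_weight_bound N N' b r c c' f w s :
  2 < s -> 3 < N' -> c <= c' -> 0 < c' -> N * c = f -> N' * c' = f -> b <= N ->
  b * c + r * c' <= w -> s * w <= s.+1 * f -> b + r + 2 < N + N'.
Proof.
move=> s2 N'3 cc' c'0 Nf N'f bN bw wf.
have {bN} [t Nt] : exists t, N = b + t by exists (N - b); lia.
have {cc'} [e ce] : exists e, c' = c + e by exists (c' - c); lia.
have sr : s * r * c' <= (s * t + N') * c'.
  have : s * (b * c + r * c') <= s.+1 * f by apply: leq_trans wf; rewrite leq_mul2l bw orbT.
  by rewrite mulSn -{1}N'f -Nf Nt; nia.
rewrite leq_pmul2r // in sr; rewrite Nt; nia.
Qed.

(** * Extremal families and the equality cases *)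

Section Extremal.
Hypothesis n3 : 2 < n.
Local Notation h := n./2.

Let q1 := cardF_gt1.
Let nh : h.+1 <= n. Proof. by lia. Qed.
Let nh' : h <= n. Proof. by lia. Qed.

(** Weights grow with max(k, n - k), which is smallest at [h]; the next value is reached at [h.+1],
    and for odd n the two tie. *)
Lemma weight_outer (x : V) : \dim x != h -> nflags q n h.+1 <= wt x.
Proof.
move=> xh; rewrite weightE; apply: nflags_le; rewrite ?dim_le //.
by have := dim_le x; move/eqP: xh; move: (\dim x) => k; lia.
Qed.

Lemma no_fork_extremal (A : {set V}) : no_fork A ->
  qbinom q n h + qbinom q n h.+1 <= #|A| ->
  [/\ #|A| = qbinom q n h + qbinom q n h.+1, mids A = set0,
      forall x, x \in A -> \dim x != h -> wt x = nflags q n h.+1 &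
      layer h \subset A \/ nflags q n h = nflags q n h.+1].
Proof.
move=> nfA leA.
have cc' : nflags q n h <= nflags q n h.+1 by apply: nflags_le => //; lia.
have c'0 := nflags_gt0 n h.+1 q1.
have N'4 : 3 < qbinom q n h.+1 by apply: qbinom_ge4 => //; lia.
have Nf : qbinom q n h * nflags q n h = #|flg| by rewrite card_flags qbinomE.
have N'f : qbinom q n h.+1 * nflags q n h.+1 = #|flg| by rewrite card_flags qbinomE.
have leN (B : {set V}) : #|B :&: layer h| <= qbinom q n h.
  by rewrite -card_layer // subset_leq_card // subsetIr.
pose E : {set V} := [set (0%VS : V); (fullv : V)].
have gapE (B : {set V}) : [disjoint B & E] -> {in B &, forall m x, x != m -> (x >=< m)%O ->
    q.+1 * #|through mb (through mb flg m) x| <= wt m}.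
  move=> BE m x _ xB xm cxm.
  have := disjointFr BE xB; rewrite !inE => /negbT; rewrite negb_or => /andP[x0 x1].
  exact: weight_gap.
(* If 0 or the whole space were in [A], the rest of [A] would miss the bound by more than two, while
   [E] has at most two elements. *)
have AE : [disjoint A & E].
  apply/pred0P => e /=; apply/negP => /andP[eA eE].
  have ext : (forall x, x \in A -> (e <= x)%O) \/ (forall x, x \in A -> (x <= e)%O).
    move: eE; rewrite !inE => /orP[] /eqP ->; [left|right] => x _.
      exact: sub0v.
    exact: subvf.
  have BA : A :\: E \subset A :\ e.
    by apply/subsetP => x; rewrite in_setD in_setD1 => /andP[xE ->]; rewrite andbT;
      apply: contraNneq xE => ->.
  have := lym_extremum (@members_comparable F n) nfA eA ext BA (gapE _ _).
  rewrite disjoint_sym disjoints_subset; rewrite setCD subsetUr => /(_ isT) wB.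
  have := extremum_weight_bound _ N'4 cc' c'0 Nf N'f (leN _) (sum_weight_ge _ weight_outer).1 wB.
  rewrite ltnS => /(_ q1); rewrite cardsID ltnNge => /negP; apply.
  apply: leq_trans leA _; rewrite -(cardsID E A) addnC leq_add2l.
  by rewrite (leq_trans (subset_leq_card (subsetIr _ _))) // cards2; case: eqP.
have := lym_mids (@members_comparable F n) (leqW q1) nfA (gapE _ AE).
set w := \sum_(x in A) _; set wM := \sum_(m in _) _ => lym.
have w2 : w <= 2 * #|flg|.
  by rewrite -(leq_pmul2l (ltn0Sn q)) mulnA; apply: leq_trans lym; apply: leq_addr.
have ge := sum_weight_ge A weight_outer.
have [] := two_layers_optimum cc' c'0 Nf N'f (leN A) ge.1 w2 _; first by rewrite cardsID.
rewrite cardsID => cA wE eqw a_or; split=> //.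
(* The total weight is exactly [2 * #|flg|], so the slack term of [lym_mids], with coefficient q - 1
   > 0, vanishes. *)
- have wM0 : wM = 0.
    move: lym; rewrite /w wE mulnA -[leqRHS]addn0 leq_add2l leqn0 muln_eq0.
    by case/orP => [|/eqP//]; rewrite subn_eq0 ltnS leqNgt q1.
  apply/eqP; apply: contraT => /set0Pn[m mM]; move/eqP: wM0.
  by rewrite /wM sum_nat_eq0 => /forall_inP/(_ m mM); rewrite weightE -leqn0 leqNgt nflags_gt0.
- move=> x xA xh; have : [forall x in A :\: layer h, nflags q n h.+1 == wt x] by rewrite -ge.2 eqw.
  by move/forall_inP/(_ x) => H; apply/esym/eqP/H; rewrite !inE xA xh.
- case: a_or => [aN|]; [left|by right].
  by apply/setIidPr/eqP; rewrite eqEcard subsetIr aN card_layer ?leqnn.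
Qed.

Lemma no_fork_odd (A : {set V}) : odd n -> no_fork A ->
  #|A| = qbinom q n h + qbinom q n h.+1 -> A = layer h :|: layer h.+1.
Proof.
move=> on nfA cA; have [] := no_fork_extremal nfA; first by rewrite cA.
move=> _ _ wtA _; apply/eqP; rewrite eqEcard card_layerU ?cA ?leqnn ?andbT //; last by lia.
apply/subsetP => x xA; rewrite !inE; case: eqP => //= /eqP xh.
apply: contraT => /eqP xh'.
(* For odd n, any dimension other than [h] and [h.+1] is strictly heavier. *)
have := ltnn (nflags q n h.+1); rewrite -{2}(wtA x xA xh) weightE nflags_lt ?dim_le //.
have := dim_le x; move/eqP: xh xh'; move: (\dim x) => k; lia.
Qed.

Lemma no_fork_even (A : {set V}) : ~~ odd n -> no_fork A ->
  #|A| = qbinom q n h + qbinom q n h.+1 ->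
  A = layer h :|: layer h.+1 \/ A = layer h :|: layer h.-1.
Proof.
move=> en nfA cA; have [] := no_fork_extremal nfA; first by rewrite cA.
move=> _ mid0 wtA lA.
have nE : n = h + h by lia.
have {}lA : layer h \subset A.
  case: lA => // e; have := ltnn (nflags q n h); rewrite {2}e nflags_lt //; lia.
have dA x : x \in A -> [|| \dim x == h, \dim x == h.+1 | \dim x == h.-1].
  move=> xA; case: (eqVneq (\dim x) h) => //= xh; apply: contraT;
    rewrite negb_or => /andP[/eqP x1 /eqP x2].
  have := ltnn (nflags q n h.+1); rewrite -{2}(wtA x xA xh) weightE nflags_lt ?dim_le //.
  have := dim_le x; move/eqP: xh x1 x2; move: (\dim x) => k; lia.
(* The layers below, at and above the middle become [k], [k.+1] and [k.+2]. *)
have [k hk] : exists k, h = k.+1 by exists h.-1; lia.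
have kn : k.+2 < n by lia.
have ekk : nflags q n k = nflags q n k.+2 by rewrite nflags_sym //; [congr nflags; lia|lia].
have qkk : qbinom q n k = qbinom q n k.+2.
  by apply/eqP; rewrite -(eqn_pmul2r (nflags_gt0 n k q1)) {2}ekk !qbinomE //; lia.
move: lA dA cA; rewrite hk /= => lA dA cA.
pose S := A :&: layer k; pose T := A :&: layer k.+2.
(* A subspace of middle dimension between [U] and [W] lies in [A], hence would be a middle
   element. *)
have nST U W : U \in S -> W \in T -> (U <= W)%VS -> False.
  rewrite !inE => /andP[UA /eqP dU] /andP[WA /eqP dW] UW.
  have [Z [UZ ZW dZ]] : exists Z : V, [/\ (U <= Z)%VS, (Z <= W)%VS & \dim Z = k.+1].
    by apply: subspace_between => //; rewrite dU dW !leqnSn.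
  have : Z \in mids A.
    apply/midsP; exists U, W; split=> //.
    - by apply: (subsetP lA); rewrite inE dZ.
    - by rewrite lt_neqAle leEsubspaces UZ andbT; apply: contra_eq_neq dZ => <-; rewrite dU; lia.
    - by rewrite lt_neqAle leEsubspaces ZW andbT; apply: contra_eq_neq dZ => ->; rewrite dW; lia.
  by rewrite mid0 inE.
have cST : #|S| + #|T| = #|@layer F n k.+2|.
  apply: (@addnI #|@layer F n k.+1|); rewrite card_layer ?(ltnW kn) //; last by lia.
  rewrite card_layer ?(ltnW kn) // -cA -(cardsID (layer k.+1) A) (setIidPr lA) card_layer; last by lia.
  congr (_ + _); rewrite (_ : A :\: _ = S :|: T).
    rewrite cardsU (_ : S :&: T = set0) ?cards0 ?subn0 //; apply/setP => x; rewrite !inE.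
    by apply/negP => /andP[/andP[_ /eqP dx] /andP[_ /eqP]]; rewrite dx; lia.
  apply/setP => x; rewrite !inE; case: (boolP (x \in A)) => [xA|_]; last by rewrite andbF.
  have := dA x xA; move: (\dim x) => j; rewrite andbT /=; lia.
have split := flags_split (ltnW kn) (subsetIr _ _) (subsetIr _ _) ekk cST nST.
have [S0|S0] := eqVneq S set0.
  left; apply/eqP; rewrite eqEcard cA card_layerU ?leqnn ?andbT //; try lia.
  apply/subsetP => x xA; rewrite !inE; case/or3P: (dA x xA) => [->//|->|dx]; first by rewrite orbT.
  by have := in_set0 x; rewrite -S0 inE xA inE dx.
right; apply/eqP; rewrite eq_sym eqEcard cA card_layerU ?qkk ?leqnn ?andbT //; try lia.
rewrite subUset lA /=; apply: subset_trans (subsetIl A (layer k)).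
apply: (exchange_connected (ltnW kn) _ (subsetIr _ _) S0).
(* Either [U'] is in [S] or [W] is in [T]; the latter is excluded because [U] in [S] lies below
   [W]. *)
move=> U U' W US dU' dW UW U'W; case/orP: (split U' W dU' dW U'W) => // WT.
by case: (nST U W).
Qed.

(** A butterfly would have two distinct k-dimensional bottoms, whose sum has dimension at least k +
    1 and so equals both tops. *)
Lemma layers_butterfly_free k :
  poset_free [:: butterfly : finPOrderType _] (layer k :|: layer k.+1 : {set V}).
Proof.
rewrite /= andbT; apply/negP => /existsP[f /and3P[/injectiveP fI /forallP fA fle]].
have le x y : (x <= y)%O -> (f x <= f y)%O.
  by have /forallP/(_ y)/implyP := forallP fle x.
have lt x y : x != y -> (x <= y)%O -> (f x < f y)%O.
  by move=> xy /le xy'; rewrite lt_neqAle xy' andbT (inj_eq fI).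
have dims x y : x != y -> (x <= y)%O -> \dim (f x) = k /\ \dim (f y) = k.+1.
  move=> xy /(lt x y xy)/dim_lt; have := fA x; have := fA y; rewrite !inE.
  by do 2![case/orP => /eqP ->]; lia.
have [da dc] := dims pa pc isT isT; have [db dd] := dims pb pd isT isT.
have ab : k < \dim (f pa + f pb)%VS.
  rewrite ltnNge; apply/negP => le_k.
  have /eqP Ea : (f pa == f pa + f pb :> {vspace _})%VS by rewrite eqEdim addvSl da.
  have /eqP Eb : (f pb == f pa + f pb :> {vspace _})%VS by rewrite eqEdim addvSr db.
  by have := fI pa pb (etrans Ea (esym Eb)).
have top x : (pa <= x :> butterfly)%O -> (pb <= x :> butterfly)%O -> \dim (f x) = k.+1 ->
    (f pa + f pb)%VS = f x.
  move=> /le ax /le bx dx; apply/eqP; rewrite eqEdim dx ab andbT subv_add.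
  by rewrite -!leEsubspaces ax.
by have := fI pc pd (etrans (esym (top pc isT isT dc)) (top pd isT isT dd)).
Qed.
End Extremal.
End Subspaces.

Theorem theoremC (p e q n : nat) (F : finFieldType)
    (hp : prime p) (he : 0 < e) (hq : q = p ^ e) (hF : #|F| = q)
    (hn : 3 <= n) :
  [/\ extremal (subspaces F n) [:: butterfly : finPOrderType _] =
        extremal (subspaces F n) [:: posetY : finPOrderType _;
                               posetY' : finPOrderType _],
      extremal (subspaces F n) [:: posetY : finPOrderType _;
                             posetY' : finPOrderType _] =
        qbinom q n n./2 + qbinom q n n./2.+1 &
      forall A : {set subspaces F n},
        #|A| = qbinom q n n./2 + qbinom q n n./2.+1 ->
        poset_free [:: butterfly : finPOrderType _] A \/
        poset_free [:: posetY : finPOrderType _; posetY' : finPOrderType _] A ->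
        (odd n -> A = layer n./2 :|: layer (uphalf n)) /\
        (~~ odd n -> A = layer n./2 :|: layer n./2.+1 \/
                     A = layer n./2 :|: layer n./2.-1)].
Proof.
have up (A : {set subspaces F n}) :
    poset_free [:: posetY : finPOrderType _; posetY' : finPOrderType _] A ->
    #|A| <= qbinom q n n./2 + qbinom q n n./2.+1.
  move=> /YY'_free_no_fork nfA; rewrite -hF leqNgt; apply/negP => ltA.
  by have [cA _ _ _] := no_fork_extremal hn nfA (ltnW ltA); rewrite cA ltnn in ltA.
(* With [mid] and [up] this closes a cycle of inequalities, so both extremal numbers equal the
   sum. *)
have low : qbinom q n n./2 + qbinom q n n./2.+1 <=
    extremal (subspaces F n) [:: butterfly : finPOrderType _].
  rewrite -hF -(card_layerU F (n := n)); try lia.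
  exact/leq_bigmax_cond/layers_butterfly_free.
have mid : extremal (subspaces F n) [:: butterfly : finPOrderType _] <=
    extremal (subspaces F n) [:: posetY : finPOrderType _; posetY' : finPOrderType _].
  by apply/bigmax_leqP => A /butterfly_free_YY' fA; apply: leq_bigmax_cond.
have {}up : extremal (subspaces F n) [:: posetY : finPOrderType _; posetY' : finPOrderType _] <=
    qbinom q n n./2 + qbinom q n n./2.+1 by apply/bigmax_leqP.
split; try by apply/eqP; rewrite eqn_leq; apply/andP; split; lia.
move=> A cA freeA.
have nfA : no_fork A.
  by apply: YY'_free_no_fork; case: freeA => // /butterfly_free_YY'.
rewrite -hF in cA; split=> [on|en]; last exact: no_fork_even.
by rewrite uphalfE (_ : n.+1./2 = n./2.+1); [apply: no_fork_odd | lia].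
Qed.
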